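(* Let $n,r,s$ be positive integers and $l,f$ integers. Suppose $(n,l-1)=1$, $(r,s)=1$, $r\neq s$, and $f(r-s)\equiv 0\bmod n$. Then $P(r,n,l,s,f)$ is the metacyclic group \[B\left((n,f)(r^n-s^n)/n,\ n/(n,f),\ (s\hat{r})^{f\bar{A}},\ 1\right)\] of order $|r^n-s^n|$, where $(l-1)\bar{A}\equiv 1\bmod n$ and $r\hat{r}\equiv 1\bmod (r^n-s^n)$.
   Context: $(a,b)$ denotes the greatest common divisor, with $(n,0)=n$. For a word $w$ in $x_0,\dots,x_{n-1}$, $G_n(w)=\langle x_0,\dots,x_{n-1}\mid w,\theta(w),\dots,\theta^{n-1}(w)\rangle$ where $\theta(x_i)=x_{i+1}$, subscripts modulo $n$. For $r,s>0$, $P(r,n,l,s,f)=G_n\big((x_0x_f\cdots x_{(r-1)f})(x_{(l-1)}x_{(l-1)+f}\cdots x_{(l-1)+(s-1)f})^{-1}\big)$. For integers $M,N,R,\lambda$ with $R^N\equiv 1\bmod M$, $B(M,N,R,\lambda)=\langle a,b\mid a^M=1,\ bab^{-1}=a^R,\ b^N=a^{\lambda M/(M,R-1)}\rangle$. The parameter $R$ matters only modulo $M$; powers of the unit $s\hat r$ with possibly negative exponents are read modulo $r^n-s^n$. A group is metacyclic if it has a cyclic normal subgroup with cyclic quotient. *)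

(* Defs.v *)
(* MathComp; MathComp-Analysis is used only for classical decidability of the
   congruence that defines a presented group. *)
From HB Require Import structures.
From mathcomp Require Import all_boot all_order all_algebra all_fingroup.
From mathcomp Require Import all_solvable.
From mathcomp Require Import boolp.

Set Implicit Arguments.
Unset Strict Implicit.
Unset Printing Implicit Defensive.

Import Order.TTheory GRing.Theory Num.Theory.

(* The letter (i, true) is the generator x_i, and (i, false) is its inverse. *)
Definition word (I : Type) : Type := seq (I * bool).

Section Words.
Variable I : Type.

Definition gen (i : I) : word I := [:: (i, true)].

Definition wflip (c : I * bool) : I * bool := (c.1, ~~ c.2).

Definition winv (w : word I) : word I := rev (map wflip w).

Definition wexp (w : word I) (z : int) : word I :=
  match z with
  | Posz k => flatten (nseq k w)
  | Negz k => flatten (nseq k.+1 (winv w))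
  end.

(* The least congruence on words that cancels inverse pairs and identifies the
   two sides of every relation; (u, v) is the relation u = v. *)
Inductive pres_eq (rels : seq (word I * word I)) : word I -> word I -> Prop :=
| PresRel k of k < size rels :
    pres_eq rels (nth ([::], [::]) rels k).1 (nth ([::], [::]) rels k).2
| PresCancel c : pres_eq rels [:: c; wflip c] [::]
| PresCat u u' v v' of pres_eq rels u u' & pres_eq rels v v' :
    pres_eq rels (u ++ v) (u' ++ v')
| PresRefl u : pres_eq rels u u
| PresSym u v of pres_eq rels u v : pres_eq rels v u
| PresTrans u v w of pres_eq rels u v & pres_eq rels v w : pres_eq rels u w.

Lemma wflipK : involutive wflip.
Proof. by case=> i b; rewrite /wflip /= negbK. Qed.

Lemma winv_cat u v : winv (u ++ v) = winv v ++ winv u.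
Proof. by rewrite /winv map_cat rev_cat. Qed.

Lemma winvK : involutive winv.
Proof. by move=> w; rewrite /winv map_rev revK (mapK wflipK). Qed.

Lemma pres_mulV rels w : pres_eq rels (w ++ winv w) [::].
Proof.
elim: w => [|c w IHw]; first exact: PresRefl.
rewrite -cat1s winv_cat catA -(catA [:: c]).
apply: (@PresTrans _ _ ([:: c] ++ winv [:: c])); last exact: PresCancel.
apply: PresCat; last exact: PresRefl.
rewrite -[X in pres_eq _ _ X]cats0.
by apply: PresCat => //; apply: PresRefl.
Qed.

Lemma pres_inv rels u v : pres_eq rels u v -> pres_eq rels (winv u) (winv v).
Proof.
move=> uv.
apply: (@PresTrans _ _ (winv u ++ (v ++ winv v))).
  rewrite -[X in pres_eq _ X]cats0.
  by apply: PresCat; [exact: PresRefl | apply/PresSym/pres_mulV].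
rewrite catA -[X in pres_eq _ _ X]cat0s.
apply: PresCat; last exact: PresRefl.
apply: (@PresTrans _ _ (winv u ++ u)).
  by apply: PresCat; [exact: PresRefl | exact: PresSym].
by rewrite -{2}(winvK u); apply: pres_mulV.
Qed.

End Words.

Section PresentedGroup.
Variables (I : choiceType) (rels : seq (word I * word I)).

Definition pres_eqb (u v : word I) : bool := `[< pres_eq rels u v >].

Lemma pres_eqb_refl : reflexive pres_eqb.
Proof. by move=> u; apply/asboolP/PresRefl. Qed.

Lemma pres_eqb_sym : symmetric pres_eqb.
Proof. by move=> u v; apply/asboolP/asboolP => /PresSym. Qed.

Lemma pres_eqb_trans : transitive pres_eqb.
Proof.
by move=> v u w /asboolP uv /asboolP vw; apply/asboolP/(PresTrans uv vw).
Qed.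

Canonical pres_equiv :=
  EquivRel pres_eqb pres_eqb_refl pres_eqb_sym pres_eqb_trans.

Definition presented : Type := {eq_quot pres_equiv}%qT.

HB.instance Definition _ := Choice.on presented.
HB.instance Definition _ := EqQuotient.on presented.

Local Open Scope quotient_scope.
Local Notation repr := generic_quotient.repr.

Definition pres_class (w : word I) : presented := \pi_presented w.
Definition pres_one : presented := pres_class [::].
Definition pres_mul (x y : presented) : presented :=
  pres_class (repr x ++ repr y).
Definition pres_inverse (x : presented) : presented :=
  pres_class (winv (repr x)).

Lemma pres_classP u v : pres_class u = pres_class v <-> pres_eq rels u v.
Proof.
split=> [/eqmodP /asboolP // | uv].
by apply/eqmodP/asboolP.
Qed.

Lemma pres_classK x : pres_class (repr x) = x.
Proof. exact: reprK. Qed.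

Lemma pres_repr w : pres_eq rels (repr (pres_class w)) w.
Proof. by apply/pres_classP; rewrite pres_classK. Qed.

Lemma pres_mulE u v : pres_mul (pres_class u) (pres_class v) = pres_class (u ++ v).
Proof. by apply/pres_classP/PresCat; apply: pres_repr. Qed.

Lemma pres_inverseE u : pres_inverse (pres_class u) = pres_class (winv u).
Proof. exact/pres_classP/pres_inv/pres_repr. Qed.

Lemma pres_mulgA : associative pres_mul.
Proof.
move=> x y z; rewrite -(pres_classK x) -(pres_classK y) -(pres_classK z).
by rewrite !pres_mulE catA.
Qed.

Lemma pres_mul1g : left_id pres_one pres_mul.
Proof. by move=> x; rewrite -(pres_classK x) pres_mulE. Qed.

Lemma pres_mulg1 : right_id pres_one pres_mul.
Proof. by move=> x; rewrite -(pres_classK x) pres_mulE cats0. Qed.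

Lemma pres_mulgV : right_inverse pres_one pres_inverse pres_mul.
Proof.
move=> x; rewrite -(pres_classK x) pres_inverseE pres_mulE.
exact/pres_classP/pres_mulV.
Qed.

Lemma pres_mulVg : left_inverse pres_one pres_inverse pres_mul.
Proof.
move=> x; rewrite -(pres_classK x) pres_inverseE pres_mulE.
by apply/pres_classP; rewrite -{2}(winvK (repr x)); apply: pres_mulV.
Qed.

HB.instance Definition _ := isGroup.Build presented
  pres_mulgA pres_mul1g pres_mulg1 pres_mulVg pres_mulgV.

End PresentedGroup.

Definition isomorphic (G H : groupType) : Prop :=
  exists phi : {multiplicative G -> H}, bijective phi.

(* The abstract group G is finite of order m and metacyclic, the latter being
   expressed by the library's predicate on a finite group isomorphic to G. *)
Definition metacyclic_of_order (G : groupType) (m : nat) : Prop :=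
  exists gT : finGroupType,
    [/\ isomorphic G gT, #|gT| = m & metacyclic [set: gT]].

Section CyclicPresentations.
Variables (n : nat) (n_gt0 : 0 < n).

(* theta is the shift x_i |-> x_(i+1), subscripts modulo n. *)
Definition theta (w : word 'I_n) : word 'I_n :=
  [seq (ordS c.1, c.2) | c <- w].

Definition cyclically_presented (w : word 'I_n) : groupType :=
  presented [seq (iter j theta w, [::] : word 'I_n) | j <- iota 0 n].

Lemma subscript_subproof (z : int) : (`|(z %% n)%Z| < n)%N.
Proof.
have n0 : (n%:Z != 0)%R by rewrite -lt0n.
by rewrite -ltz_nat gez0_abs ?modz_ge0 // ltz_pmod.
Qed.

Definition subscript (z : int) : 'I_n := Ordinal (subscript_subproof z).

(* x_z x_(z+f) ... x_(z+(k-1)f) *)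
Definition progression (z f : int) (k : nat) : word 'I_n :=
  [seq (subscript (z + i%:Z * f)%R, true) | i <- iota 0 k].

Definition group_P (r : nat) (l : int) (s : nat) (f : int) : groupType :=
  cyclically_presented
    (progression 0 f r ++ winv (progression (l - 1)%R f s)).

End CyclicPresentations.

(* An integer inverse of u modulo m when u and m are coprime. *)
Definition invz_mod (m u : int) : int := (egcdz u m).1.

(* An integer representing u ^ e modulo m, for u coprime to m and any e. *)
Definition expz_mod (m u e : int) : int :=
  match e with
  | Posz k => (u ^+ k)%R
  | Negz k => (invz_mod m u ^+ k.+1)%R
  end.

(* The condition R^N = 1 mod M required of the parameters of group_B. *)
Definition group_B_condition (M N R : int) : Prop :=
  (expz_mod M R N = 1 %[mod M])%Z.

Definition group_B (M N R lambda : int) : groupType :=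
  let a : word bool := gen false in
  let b : word bool := gen true in
  presented
    [:: (wexp a M, [::]);
        (b ++ a ++ winv b, wexp a R);
        (wexp b N, wexp a ((lambda * M) %/ gcdz M (R - 1))%Z)].

(* Main.v *)
Require Import Defs.
From HB Require Import structures.
From mathcomp Require Import all_boot all_order all_algebra all_fingroup.
From mathcomp Require Import all_solvable ring zify.
From mathcomp Require Import boolp.

Set Implicit Arguments.
Unset Strict Implicit.
Unset Printing Implicit Defensive.

Import Order.TTheory GRing.Theory Num.Theory.
Local Open Scope ring_scope.

(** Write D = r^n - s^n, A = l - 1 and q = s rhat, so that r q = s and q^n = 1
    modulo D.  Both presented groups are shown to be isomorphic to one explicit
    group of order |D|: the set Z/D with the twisted law

      x * y = x + R^x y,   where R = q^(f Abar) modulo D.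

    This law comes from extending P by its shift t.  With y = x_0 t^f and
    u = t^A the extension is generated by y and u subject to u^n = 1 and
    y^r = u y^s u^-1; so y has order D, u acts on it as multiplication by a
    power of q, and the elements y^k t^(- k f) of P are indexed by k in Z/D.
    The product of two of them is the twisted law.  It is well defined because,
    for N = n/(n,f), one has R^N = 1, N divides D, and R = 1 modulo N: then R^x
    depends on x modulo D only, and x |-> R^x turns the twisted law into
    multiplication ([twistD], [twistM1]).

    The group P.  The assignment x_i |-> q^(- Abar i) respects the defining
    relations ([run_image]).  Conversely, consider in P the runs
    p(i,k) = x_i x_(i+f) ... x_(i+(k-1)f).  The relations give
    p(i,rk) = p(i+A,sk), the congruence f(r-s) = 0 making the blocks of r and of
    s letters match up; hence p(i,r^n) = p(i+nA,s^n) = p(i,s^n) and p(j,|D|) = 1,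
    so p(i,k) depends on k modulo D only.  As r is invertible modulo D and A
    modulo n, every run can be moved to start at any given place, and so every
    element of P is a run p(0,k) ([runM], [run_inv]).  The homomorphism sends
    p(0,k) to k, and is therefore bijective.

    The group B.  In the twisted group take b = 1 and a = N w with w a unit.
    The multiples of N form a cyclic normal subgroup on which the law is the
    addition, b acts on it by R, and b^N = 1 + R + ... + R^(N-1).  The relations
    of B allow every element to be written a^i b^j with i < |M| and j < N; since
    |M| N = |D|, a surjective homomorphism from B onto the twisted group is
    injective ([group_B_twisted]).  What remains is to choose w so that
    b^N = a^(M/(M,R-1)), and this is where the arithmetic enters.  Put d = (n,f),
    x = r^d, y = s^d and let E' N be the sum of the x^(N-1-i) y^i, a multiple of N
    because r = s modulo N.  Then D = (x - y) E' N and M = (x - y) E'.  Moreover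
    R is a power of q^d with exponent prime to N, so R and q^d generate the same
    group; this yields (M,R-1) = |x - y| ([gcdz_parameters]) and lets q^d replace
    R in the sum ([sum_perpow]), which then equals E' N / x^(N-1)
    ([sum_powers_ratio]).  The unit w is 1 / x^(N-1) up to the sign of x - y. *)

(** * Homomorphisms out of a presented group *)

Section Evaluation.
Variables (I : Type) (G : groupType) (g : I -> G).

Definition letter_value (c : I * bool) : G :=
  if c.2 then g c.1 else ((g c.1)^-1)%g.

Definition eval (w : word I) : G := (\prod_(c <- w) letter_value c)%g.

Lemma eval_nil : eval [::] = 1%g.
Proof. exact: big_nil. Qed.

Lemma eval_cons c w : eval (c :: w) = (letter_value c * eval w)%g.
Proof. exact: big_cons. Qed.

Lemma eval_cat u v : eval (u ++ v) = (eval u * eval v)%g.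
Proof. exact: big_cat. Qed.

Lemma eval_gen i : eval (gen i) = g i.
Proof. exact: big_seq1. Qed.

Lemma eval_winv w : eval (winv w) = ((eval w)^-1)%g.
Proof.
elim: w => [|[i []] w IHw]; first by rewrite eval_nil invg1.
  by rewrite -cat1s winv_cat !eval_cat IHw invgM /eval !big_seq1.
rewrite -cat1s winv_cat !eval_cat IHw invgM /eval !big_seq1.
by rewrite /letter_value /= invgK.
Qed.

Definition expgz (x : G) (z : int) : G :=
  match z with Posz k => (x ^+ k)%g | Negz k => (x^-1 ^+ k.+1)%g end.

Lemma eval_wexp w z : eval (wexp w z) = expgz (eval w) z.
Proof.
have evalX u k : eval (flatten (nseq k u)) = (eval u ^+ k)%g.
  by elim: k => [|k IHk] /=; rewrite ?eval_nil // eval_cat IHk expgS.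
by case: z => k; rewrite /wexp evalX ?eval_winv.
Qed.

End Evaluation.

Section Presentation.
Variables (I : choiceType) (rels : seq (word I * word I)).

Lemma eval_pres_eq (G : groupType) (g : I -> G) u v :
    (forall p, p \in rels -> eval g p.1 = eval g p.2) ->
  pres_eq rels u v -> eval g u = eval g v.
Proof.
move=> relsE.
elim=> {u v}
  [k ltk|[i b]|u u' v v' _ IHu _ IHv|//|//|u v w _ IHu _ IHv].
- by apply: relsE; rewrite mem_nth.
- case: b; rewrite /eval big_cons big_seq1 big_nil /letter_value /=.
    exact: mulgV.
  exact: mulVg.
- by rewrite !eval_cat IHu IHv.
- by rewrite IHu.
Qed.

Definition pres_gen (i : I) : presented rels := pres_class rels (gen i).

Lemma pres_class_eval w : pres_class rels w = eval pres_gen w.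
Proof.
elim: w => [|[i b] w IHw]; first by rewrite eval_nil.
rewrite eval_cons -IHw -cat1s -pres_mulE; congr pres_mul.
case: b => //.
have -> : letter_value pres_gen (i, false) = pres_inverse (pres_gen i) by [].
by rewrite pres_inverseE.
Qed.

Lemma pres_relation p : p \in rels -> eval pres_gen p.1 = eval pres_gen p.2.
Proof.
move=> /(nthP ([::], [::])) [k ltk <-].
by rewrite -!pres_class_eval; apply/pres_classP/PresRel.
Qed.

Lemma pres_ind (S : presented rels -> Prop) :
    S 1%g -> (forall i x, S x -> S (pres_gen i * x)%g) ->
    (forall i x, S x -> S ((pres_gen i)^-1 * x)%g) ->
  forall x, S x.
Proof.
move=> S1 Smul Sinv x; rewrite -(pres_classK x).
elim: (generic_quotient.repr x) => [|[i b] w IHw]; first exact: S1.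
rewrite pres_class_eval eval_cons -pres_class_eval.
by case: b; [apply: Smul | apply: Sinv].
Qed.

(** The universal property.  The homomorphism is described by its values on
    words, which is the form in which products of generators get evaluated. *)
Lemma pres_lift (G : groupType) (g : I -> G) :
    (forall p, p \in rels -> eval g p.1 = eval g p.2) ->
  exists phi : {multiplicative presented rels -> G},
    forall w, phi (eval pres_gen w) = eval g w.
Proof.
move=> relsE.
pose phi (x : presented rels) : G := eval g (generic_quotient.repr x).
have phiE w : phi (pres_class rels w) = eval g w.
  exact: eval_pres_eq relsE (pres_repr _ _).
have phiM : {morph phi : x y / (x * y)%g >-> (x * y)%g}.
  move=> x y; rewrite -(pres_classK x) -(pres_classK y).
  by rewrite [X in phi X]pres_mulE !phiE eval_cat.
pose phi_mul := isMultiplicative.Build _ _ phi phiM.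
pose phi' : {multiplicative presented rels -> G} := HB.pack phi phi_mul.
by exists phi' => w; rewrite -pres_class_eval; apply: phiE.
Qed.

End Presentation.

Lemma bij_of_inj_surj (T U : choiceType) (h : T -> U) :
  injective h -> (forall y, exists x, h x = y) -> bijective h.
Proof.
move=> h_inj h_surj.
have hP y : exists x, h x == y by have [x <-] := h_surj y; exists x.
exists (fun y => xchoose (hP y)) => [x|y]; last exact/eqP/(xchooseP (hP y)).
exact/h_inj/eqP/(xchooseP (hP (h x))).
Qed.

Lemma isomorphic_common (G H K : groupType) :
  isomorphic G K -> isomorphic H K -> isomorphic G H.
Proof.
move=> [phi phi_bij] [psi [psi' psiK psi'K]].
pose psi'_mul := isMultiplicative.Build _ _ psi' (can2_gmulfM psiK psi'K).
pose chi : {multiplicative K -> H} := HB.pack psi' psi'_mul.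
by exists (chi \o phi)%FUN; apply: bij_comp phi_bij; exists psi.
Qed.

(** * Residue rings and the twisted group *)

(** The ring of integers modulo m + 1, trivial for m = 0; 'Z_(m.+1) would have two
    elements there, whereas |r^n - s^n| may be 1. *)
Definition residue (m : nat) : Type := 'I_m.+1.

HB.instance Definition _ m := GRing.Zmodule.on (residue m).
HB.instance Definition _ m := Finite.on (residue m).
HB.instance Definition _ m := GRing.Zmodule_isComPzRing.Build (residue m)
  (@Zp_mulA m.+1) (@Zp_mulC m.+1) (@Zp_mul1z m) (@Zp_mul_addl m.+1).

Section Residue.
Variable m : nat.
Implicit Type x : residue m.

Lemma residue_nat k : k%:R = inZp k :> residue m.
Proof.
elim: k => [|k IHk]; first by apply: val_inj; rewrite /= mod0n.
by rewrite -natr1 IHk; apply: val_inj; rewrite /= modnDm addn1.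
Qed.

Lemma natr_residue x : (x : 'I_m.+1)%:R = x.
Proof. by rewrite residue_nat valZpK. Qed.

Lemma residue_int_eq (D y z : int) : `|D|%N = m.+1 ->
  y%:~R = z%:~R :> residue m <-> (y = z %[mod D])%Z.
Proof.
move=> DE.
have natE k : (k%:R == 0 :> residue m) = (m.+1 %| k)%N.
  by rewrite residue_nat -val_eqE /= /dvdn.
have intE (x : int) : (x%:~R == 0 :> residue m) = (D %| x)%Z.
  by case: x => k; rewrite dvdzE DE ?NegzE ?rmorphN /= ?oppr_eq0 ?abszN natE.
have yzE : (y%:~R == z%:~R :> residue m) = (y == z %[mod D])%Z.
  by rewrite -subr_eq0 -rmorphB intE eqz_mod_dvd.
by split=> /eqP yz; apply/eqP; rewrite ?yzE // -yzE.
Qed.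

Lemma residue_nat_eq (j k : nat) :
  j%:R = k%:R :> residue m <-> (j = k %[mod m.+1])%N.
Proof.
rewrite !residue_nat; split=> [/(congr1 (@nat_of_ord _))|jk] //.
exact: val_inj.
Qed.

End Residue.

Definition one_mod (A : pzRingType) (N : nat) (x : A) : Prop :=
  exists t, x = 1 + N%:R * t.

Lemma one_mod1 (A : pzRingType) N : one_mod N (1 : A).
Proof. by exists 0; rewrite mulr0 addr0. Qed.

Lemma one_modX (A : comPzRingType) N (x : A) k :
  one_mod N x -> one_mod N (x ^+ k).
Proof.
move=> [t ->]; elim: k => [|k [u uE]]; first exact: one_mod1.
by rewrite exprS uE; exists (t + u + N%:R * t * u); ring.
Qed.

(** The conditions on R under which x + R^x y is a group law: the first two make
    R^x depend on the residue x only, the last one gives R^(R^x y) = R^y. *)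
Record multiplier (m N : nat) := Multiplier {
  multiplier_val :> residue m;
  multiplier_dvd : (N %| m.+1)%N;
  multiplier_exp : multiplier_val ^+ N = 1;
  multiplier_mod : one_mod N multiplier_val
}.

Definition twisted m N (R : multiplier m N) : Type := residue m.

Section Twisted.
Variables (m N : nat) (R : multiplier m N).
Implicit Types x y z : residue m.

Definition twist x : residue m := (R : residue m) ^+ (x : 'I_m.+1).

Lemma twist_nat k : twist k%:R = (R : residue m) ^+ k.
Proof.
have Rm1 : (R : residue m) ^+ m.+1 = 1.
  case/dvdnP: (multiplier_dvd R) => k' ->.
  by rewrite mulnC exprM multiplier_exp expr1n.
rewrite /twist residue_nat /= [in RHS](divn_eq k m.+1) exprD mulnC exprM Rm1.
by rewrite expr1n mul1r.
Qed.

Lemma twistD x y : twist (x + y) = twist x * twist y.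
Proof.
by rewrite -(natr_residue x) -(natr_residue y) -natrD !twist_nat exprD.
Qed.

Lemma twistMn k x : twist (k%:R * x) = twist x ^+ k.
Proof. by rewrite -(natr_residue x) -natrM !twist_nat mulnC exprM. Qed.

Lemma twistMN x : twist (N%:R * x) = 1.
Proof.
by rewrite mulrC -(natr_residue x) twistMn twist_nat multiplier_exp expr1n.
Qed.

Lemma twistM1 x y : one_mod N x -> twist (x * y) = twist y.
Proof.
by move=> [t ->]; rewrite mulrDl mul1r -mulrA twistD twistMN mulr1.
Qed.

Lemma twist_eq1 x : one_mod N x -> twist x = R.
Proof. by move=> x1; rewrite -[x]mulr1 twistM1 // -[1]/(1%:R) twist_nat. Qed.

Lemma twist_1mod x : one_mod N (twist x).
Proof. exact/one_modX/multiplier_mod. Qed.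

Definition twisted_mul (x y : twisted R) : twisted R :=
  (x : residue m) + twist x * (y : residue m).

Definition twisted_inv (x : twisted R) : twisted R :=
  - (twist (- (x : residue m)) * (x : residue m)).

Lemma twisted_mulA : associative twisted_mul.
Proof.
move=> x y z; rewrite /twisted_mul twistD (twistM1 y (twist_1mod x)); ring.
Qed.

Lemma twisted_mul1 : left_id (0 : residue m) twisted_mul.
Proof.
by move=> x; rewrite /twisted_mul -[0]/(0%:R) twist_nat expr0 mul1r add0r.
Qed.

Lemma twisted_mulV : left_inverse (0 : residue m) twisted_inv twisted_mul.
Proof.
move=> x; rewrite /twisted_mul /twisted_inv -mulrN (twistM1 _ (twist_1mod _)).
by rewrite mulrN addNr.
Qed.

HB.instance Definition _ := Finite.on (twisted R).
HB.instance Definition _ := Finite_isGroup.Build (twisted R)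
  twisted_mulA twisted_mul1 twisted_mulV.

Lemma twistedM (x y : twisted R) :
  (x * y)%g = (x : residue m) + twist x * (y : residue m) :> residue m.
Proof. by []. Qed.

Lemma card_twisted : #|{: twisted R}| = m.+1.
Proof. exact: card_ord. Qed.

End Twisted.

(** * Runs of generators in arithmetic progression *)

Lemma PoszX (a k : nat) : (a ^ k)%N%:Z = a%:Z ^+ k.
Proof. by rewrite -natz natrX natz. Qed.

Section Runs.
Variables (n : nat) (f : int) (G : groupType) (x : int -> G).
Hypothesis x_mod : forall y z, (y = z %[mod n])%Z -> x y = x z.

Fixpoint run (z : int) (k : nat) : G :=
  if k is k'.+1 then (x z * run (z + f) k')%g else 1%g.

Lemma run1 z : run z 1 = x z.
Proof. exact: mulg1. Qed.

Lemma runD z j k : run z (j + k) = (run z j * run (z + j%:Z * f) k)%g.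
Proof.
elim: j z => [|j IHj] z; first by rewrite mul1g mul0r addr0.
rewrite addSn /= IHj mulgA; congr (_ * run _ _)%g.
by rewrite -addn1 PoszD; ring.
Qed.

Lemma run_mod y z k : (y = z %[mod n])%Z -> run y k = run z k.
Proof.
elim: k y z => //= k IHk y z yz; congr (_ * _)%g; first exact: x_mod.
by apply: IHk; rewrite -modzDml yz modzDml.
Qed.

Variables (r s : nat) (A : int).
Hypothesis f_rs : (f * (r%:Z - s%:Z) = 0 %[mod n])%Z.
Hypothesis run_rs : forall z, run z r = run (z + A) s.

(** A run of r k letters is cut into k blocks of r letters.  The relation turns
    them into blocks of s letters, and these are again adjacent because r f and
    s f agree modulo n. *)
Lemma run_scale z k : run z (r * k) = run (z + A) (s * k).
Proof.
elim: k z => [|k IHk] z; first by rewrite !muln0.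
rewrite !mulnS !runD run_rs IHk; congr (_ * _)%g; apply: run_mod.
apply/eqP; rewrite eqz_mod_dvd.
suff -> : z + r%:Z * f + A - (z + A + s%:Z * f) = f * (r%:Z - s%:Z).
  by rewrite -[f * _]subr0 -eqz_mod_dvd; apply/eqP.
by ring.
Qed.

(** Taking m = n brings the starting point back to z, which bounds the order:
    this is how the exponent r^n - s^n arises. *)
Lemma run_scaleX m z k : run z (r ^ m * k) = run (z + m%:Z * A) (s ^ m * k).
Proof.
elim: m z k => [|m IHm] z k; first by rewrite mul0r addr0.
rewrite expnS -mulnA run_scale mulnCA IHm expnS; congr run; last by lia.
by rewrite -addn1 PoszD; ring.
Qed.

Lemma run_exp_n z : run z (r ^ n) = run z (s ^ n).
Proof.
rewrite -[(r ^ n)%N]muln1 run_scaleX muln1; apply: run_mod.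
by rewrite addrC mulrC modzMDl.
Qed.

Variable D : nat.
Hypothesis DE : D = `|r%:Z ^+ n - s%:Z ^+ n|%N.

Lemma run_period z : run z D = 1%g.
Proof.
have shift j k :
    run (z - j%:Z * f) (j + k) = run (z - j%:Z * f) j -> run z k = 1%g.
  by rewrite runD subrK -[RHS in _ = RHS -> _]mulg1; apply: mulgI.
case/orP: (leq_total (s ^ n) (r ^ n)) => [sr|rs].
  apply: (shift (s ^ n)%N); rewrite -run_exp_n; congr run.
  by rewrite DE -!PoszX; lia.
apply: (shift (r ^ n)%N); rewrite run_exp_n; congr run.
by rewrite DE -!PoszX; lia.
Qed.

Lemma run_modD z j k : j = k %[mod D] -> run z j = run z k.
Proof.
have red i : run z i = run z (i %% D).
  rewrite {1}(divn_eq i D) addnC.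
  elim: (i %/ D)%N => [|q IHq]; first by rewrite addn0.
  by rewrite mulSn addnCA addnC runD IHq run_period mulg1.
by move=> jk; rewrite red jk -red.
Qed.

Variable rhat : nat.
Hypothesis rhatE : r * rhat = 1 %[mod D].

Lemma run_move m z k : run z k = run (z + m%:Z * A) (s ^ m * (rhat ^ m * k)).
Proof.
rewrite -run_scaleX mulnA -expnMn; apply: run_modD.
by rewrite -modnMml -modnXm rhatE modnXm exp1n modnMml mul1n.
Qed.

Variable Abar : int.
Hypothesis AbarE : (A * Abar = 1 %[mod n])%Z.
Hypothesis n_gt0 : (0 < n)%N.
Hypothesis D_gt0 : (0 < D)%N.

(** Moving a run m times by A multiplies its length by (s rhat)^m; since A is
    invertible modulo n, any starting point y can be reached. *)
Lemma run_rebase y z k : exists j, run z k = run y j.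
Proof.
pose m := `|((y - z) * Abar %% n)%Z|%N.
have mE : m%:Z = ((y - z) * Abar %% n)%Z.
  by rewrite gez0_abs ?modz_ge0 // eqz_nat -lt0n.
exists (s ^ m * (rhat ^ m * k))%N; rewrite (run_move m); apply: run_mod.
rewrite mE -modzDmr modzMml modzDmr.
apply/eqP; rewrite eqz_mod_dvd.
have -> : z + (y - z) * Abar * A - y = (y - z) * (A * Abar - 1) by ring.
by apply: dvdz_mull; rewrite -eqz_mod_dvd; apply/eqP.
Qed.

Lemma runM j k : exists i, (run 0 j * run 0 k)%g = run 0 i.
Proof.
have [k' ->] := run_rebase (0 + j%:Z * f) 0 k.
by exists (j + k')%N; rewrite runD.
Qed.

Lemma run_inv k : exists i, ((run 0 k)^-1)%g = run 0 i.
Proof.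
have [i iE] := run_rebase 0 (0 + k%:Z * f) (k * D.-1)%N.
(* The inverse is the run that completes the first k letters to k D letters. *)
exists i; apply: (mulgI (run 0 k)); rewrite mulgV -iE -runD.
rewrite -[RHS](_ : run 0 0%N = _) //; apply: run_modD.
by rewrite -mulnS prednK // modnMl mod0n.
Qed.

End Runs.

(** * The cyclically presented group *)

Section PeriodicPower.
Variables (A : pzRingType) (q : A) (n : nat).
Hypotheses (n_gt0 : (0 < n)%N) (qn1 : q ^+ n = 1).

(** The power q^z with an integer exponent, for q of finite order: reducing the
    exponent modulo n avoids any inverse of q. *)
Definition perpow (z : int) : A := q ^+ `|(z %% n)%Z|%N.

Lemma perpow_mod y z : (y = z %[mod n])%Z -> perpow y = perpow z.
Proof. by rewrite /perpow => ->. Qed.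

Lemma perpow_nat k : perpow k%:Z = q ^+ k.
Proof.
rewrite /perpow modz_nat absz_nat [in RHS](divn_eq k n) exprD mulnC exprM.
by rewrite qn1 expr1n mul1r.
Qed.

Lemma perpowD y z : perpow (y + z) = perpow y * perpow z.
Proof.
have n0 : n%:Z != 0 by rewrite eqz_nat -lt0n.
rewrite -[perpow y * _]exprD -perpow_nat PoszD !gez0_abs ?modz_ge0 //.
by apply: perpow_mod; rewrite modzDm.
Qed.

Lemma perpowX z k : perpow z ^+ k = perpow (z * k%:Z).
Proof.
elim: k => [|k IHk]; first by rewrite mulr0 (perpow_nat 0).
by rewrite exprS IHk -perpowD // -[k.+1]add1n PoszD mulrDr mulr1.
Qed.

End PeriodicPower.

Lemma perpow_mulr (A : pzRingType) (q : A) (d N : nat) z : (0 < d)%N ->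
  perpow q (d * N) (d%:Z * z) = perpow (q ^+ d) N z.
Proof.
move=> d_gt0; rewrite /perpow PoszM -mulz_modr //.
by rewrite abszM absz_nat exprM.
Qed.

Section CyclicPresentation.
Variables (n : nat) (n_gt0 : (0 < n)%N).

Lemma subscript_mod y z :
  (y = z %[mod n])%Z -> subscript n_gt0 y = subscript n_gt0 z.
Proof. by move=> yz; apply: val_inj; rewrite /= yz. Qed.

Lemma subscript_nat (i : 'I_n) : subscript n_gt0 i%:Z = i.
Proof. by apply: val_inj; rewrite /= modz_nat absz_nat modn_small. Qed.

Lemma subscript_val z : (subscript n_gt0 z = z %[mod n])%Z.
Proof. by rewrite /= gez0_abs ?modz_mod // modz_ge0 // eqz_nat -lt0n. Qed.

Lemma ordS_subscript z : ordS (subscript n_gt0 z) = subscript n_gt0 (z + 1).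
Proof.
rewrite -[LHS]subscript_nat; apply: subscript_mod.
by rewrite /= -modz_nat modz_mod -addn1 PoszD -modzDml subscript_val modzDml.
Qed.

Lemma iter_thetaE j z1 z2 f r s :
  iter j (@theta n)
    (progression n_gt0 z1 f r ++ winv (progression n_gt0 z2 f s)) =
  progression n_gt0 (z1 + j%:Z) f r ++ winv (progression n_gt0 (z2 + j%:Z) f s).
Proof.
have theta_winv w : theta (winv w) = winv (theta w).
  by rewrite /theta /winv map_rev -!map_comp.
have theta_prog z k :
    theta (progression n_gt0 z f k) = progression n_gt0 (z + 1) f k.
  rewrite /theta /progression -map_comp; apply: eq_map => i /=.
  by rewrite ordS_subscript addrAC.
elim: j => [|j IHj] /=; first by rewrite !addr0.
rewrite IHj /theta map_cat -!/(theta _) theta_winv !theta_prog.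
by rewrite -!addrA -[j.+1]addn1 PoszD.
Qed.

Lemma eval_progression (G : groupType) (g : 'I_n -> G) z f k :
  eval g (progression n_gt0 z f k) = run f (fun y => g (subscript n_gt0 y)) z k.
Proof.
elim: k z => [|k IHk] z; first exact: eval_nil.
rewrite /progression -[k.+1]/(1 + k)%N iotaD map_cat eval_cat /=.
rewrite /eval big_seq1 /letter_value /= mul0r addr0 -/(eval _ _) -IHk.
congr (_ * eval _ _)%g; rewrite -[(0 + 1)%N]addn0 iotaDl -map_comp.
apply: eq_map => i /=.
by rewrite PoszD mulrDl mul1r addrA.
Qed.

End CyclicPresentation.

Section IsoP.
Variables (n : nat) (n_gt0 : (0 < n)%N) (r s : nat) (l f Abar : int).
Variables (m N : nat) (R : multiplier m N) (q : residue m) (rhat : nat).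
Hypothesis f_rs : (f * (r%:Z - s%:Z) = 0 %[mod n])%Z.
Hypothesis AbarE : ((l - 1) * Abar = 1 %[mod n])%Z.
Hypothesis mE : m.+1 = `|r%:Z ^+ n - s%:Z ^+ n|%N.
Hypothesis rhatE : (r * rhat = 1 %[mod m.+1])%N.
Hypothesis rq : r%:R * q = s%:R.
Hypothesis qn1 : q ^+ n = 1.
Hypothesis q_1mod : one_mod N q.
Hypothesis RE : multiplier_val R = perpow q n (f * Abar).

Let rels := [seq (iter j (@theta n)
    (progression n_gt0 0 f r ++ winv (progression n_gt0 (l - 1) f s)),
    [::] : word 'I_n) | j <- iota 0 n].

Lemma run_presented z :
  run f (fun y => pres_gen rels (subscript n_gt0 y)) z r =
  run f (fun y => pres_gen rels (subscript n_gt0 y)) (z + (l - 1)) s.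
Proof.
pose j : nat := subscript n_gt0 z.
have jz : (j = z %[mod n])%Z by rewrite subscript_val.
have x_mod y y' : (y = y' %[mod n])%Z ->
    pres_gen rels (subscript n_gt0 y) = pres_gen rels (subscript n_gt0 y').
  by move=> yy'; rewrite (subscript_mod n_gt0 yy').
have: (iter j (@theta n) (progression n_gt0 0 f r
    ++ winv (progression n_gt0 (l - 1) f s)), [::] : word 'I_n) \in rels.
  by apply/mapP; exists j; rewrite // mem_iota /=; apply: ltn_ord.
move/pres_relation; rewrite /= iter_thetaE eval_cat eval_winv eval_nil.
rewrite !eval_progression add0r => /divg1_eq.
rewrite (run_mod f x_mod r jz) => ->; apply: (run_mod f x_mod s).
by rewrite [z + _]addrC -modzDmr jz modzDmr.
Qed.

Definition gen_image (i : 'I_n) : twisted R := perpow q n (- (Abar * i%:Z)).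

Lemma gen_imageE z :
  gen_image (subscript n_gt0 z) = perpow q n (- (Abar * z)) :> residue m.
Proof.
by apply: perpow_mod; rewrite -modzNm -modzMmr subscript_val modzMmr modzNm.
Qed.

(** Every letter of the run contributes the same amount: the twist R of the
    letters before it cancels the change of subscript by f. *)
Lemma run_image z k :
  run f (fun y => gen_image (subscript n_gt0 y)) z k =
    k%:R * perpow q n (- (Abar * z)) :> residue m.
Proof.
elim: k z => [|k IHk] z /=; first by rewrite mul0r.
rewrite twistedM gen_imageE IHk twist_eq1; last exact: one_modX.
rewrite RE mulrCA -perpowD // -[in RHS](add1n k) natrD mulrDl mul1r.
congr (_ + _ * _).
by congr (perpow _ _ _); ring.
Qed.

Theorem group_P_twisted : isomorphic (group_P n_gt0 r l s f) (twisted R).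
Proof.
have rels_image p : p \in rels -> eval gen_image p.1 = eval gen_image p.2.
  case/mapP=> j _ -> /=; rewrite iter_thetaE eval_cat eval_winv eval_nil.
  apply/eqP; rewrite divg_eq1; apply/eqP.
  rewrite !eval_progression.
  apply: (etrans (run_image _ _)); apply: (etrans _ (esym (run_image _ _))).
  (* Both sides are multiples of a power of q; they agree because r q = s. *)
  rewrite -rq -mulrA; congr (_ * _).
  rewrite -[X in _ = X * _]expr1 -(perpow_nat qn1) -perpowD //.
  apply: perpow_mod; apply/eqP; rewrite eqz_mod_dvd.
  have -> : - (Abar * (0 + j%:Z)) - (1 + - (Abar * (l - 1 + j%:Z))) =
    (l - 1) * Abar - 1 by ring.
  by rewrite -eqz_mod_dvd; apply/eqP.
have [phi phiE] := pres_lift rels_image.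
exists phi; pose x z := pres_gen rels (subscript n_gt0 z).
have x_mod y z : (y = z %[mod n])%Z -> x y = x z.
  by move=> yz; rewrite /x (subscript_mod n_gt0 yz).
have phi_run k : phi (run f x 0 k) = k%:R :> residue m.
  rewrite -eval_progression phiE eval_progression.
  apply: etrans (run_image _ _) _.
  by rewrite mulr0 oppr0 (perpow_nat qn1 0) mulr1.
have runP y : exists k, y = run f x 0 k.
  have runG i : exists k, pres_gen rels i = run f x 0 k.
    have [k kE] :=
      run_rebase x_mod f_rs run_presented mE rhatE AbarE n_gt0 0 i%:Z 1.
    by exists k; rewrite -kE run1 /x subscript_nat.
  have runM := runM x_mod f_rs run_presented mE rhatE AbarE n_gt0.
  elim/pres_ind: y => [|i y [k ->]|i y [k ->]]; first by exists 0%N.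
    by have [j ->] := runG i; have [h hE] := runM j k; exists h.
  have [j ->] := runG i.
  have [j' ->] :=
    run_inv x_mod f_rs run_presented mE rhatE AbarE n_gt0 (ltn0Sn m) j.
  by have [h hE] := runM j' k; exists h.
apply: bij_of_inj_surj => [y z|y]; last first.
  by exists (run f x 0 (y : 'I_m.+1)); rewrite phi_run natr_residue.
have [[j ->] [k ->]] := (runP y, runP z); rewrite !phi_run => jk.
apply: (run_modD x_mod f_rs run_presented mE).
exact/residue_nat_eq.
Qed.

End IsoP.

(** * Two-generator metacyclic groups *)

Definition in_normal_form (G : groupType) (a b x : G) : Prop :=
  exists i j : nat, x = (a ^+ i * b ^+ j)%g.

Lemma metacyclic_of_commutation (gT : finGroupType) (a b : gT) k :
    (b * a = a ^+ k * b)%g -> (forall x, in_normal_form a b x) ->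
  metacyclic [set: gT].
Proof.
move=> ba ab_span; apply/metacyclicP; exists <[a]>%G.
have setTE : [set: gT] = (<[a]> * <[b]>)%g.
  apply/setP=> x; rewrite inE; have [i [j ->]] := ab_span x.
  by rewrite mem_mulg ?mem_cycle.
have nab : (<[b]> \subset 'N(<[a]>))%g.
  by rewrite -cycleV norms_cycle conjgE invgK mulgA ba mulgK mem_cycle.
split; first exact: cycle_cyclic.
  by rewrite /normal subsetT setTE mul_subG ?normG.
by rewrite setTE quotientMidl quotient_cyclic ?cycle_cyclic.
Qed.

Lemma expgz_eq1 (G : groupType) (x : G) M :
  expgz x M = 1%g -> (x ^+ `|M| = 1)%g.
Proof. by case: M => // k /= xk; apply: invg_inj; rewrite -expVgn invg1. Qed.

Lemma expgz_modn (G : groupType) (x : G) (M z : int) :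
  M != 0 -> expgz x M = 1%g -> expgz x z = (x ^+ `|(z %% M)%Z|)%g.
Proof.
move=> M0 /expgz_eq1 xM1.
have x_red k : (x ^+ k = x ^+ (k %% `|M|))%g.
  by rewrite {1}(divn_eq k `|M|) mulnC expgnDr expgM xM1 expg1n mul1g.
have xPosz (k : nat) : (x ^+ k = x ^+ `|(k %% M)%Z|)%g.
  by rewrite x_red -modz_abs modz_nat absz_nat.
case: z => k /=; first exact: xPosz.
apply: (mulgI (x ^+ k.+1)%g); rewrite expVgn mulgV -expgnDr.
rewrite xPosz PoszD gez0_abs ?modz_ge0 // modzDmr NegzE.
by rewrite subrr mod0z.
Qed.

Section NormalForm.
Variables (G : groupType) (a b : G) (M N k e : nat).
Hypotheses (M_gt0 : (0 < M)%N) (N_gt0 : (0 < N)%N).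
Hypotheses (aM : (a ^+ M = 1)%g) (ba : (b * a = a ^+ k * b)%g).
Hypothesis bN : (b ^+ N = a ^+ e)%g.

Lemma normal_form_mul_a i x : in_normal_form a b x ->
  in_normal_form a b (a ^+ i * x)%g.
Proof. by move=> [i' [j ->]]; exists (i + i')%N, j; rewrite expgnDr mulgA. Qed.

Lemma normal_form_mul_b j x : in_normal_form a b x ->
  in_normal_form a b (b ^+ j * x)%g.
Proof.
have baX i : (b * a ^+ i = a ^+ (k * i) * b)%g.
  elim: i => [|i IHi]; first by rewrite muln0 mulg1 mul1g.
  by rewrite expgSr mulgA IHi -mulgA ba mulgA -expgnDr mulnSr.
move=> [i [j' ->]]; elim: j => [|j [i1 [j1 IHj]]].
  by exists i, j'; rewrite mul1g.
by exists (k * i1)%N, j1.+1; rewrite expgS -mulgA IHj mulgA baX -mulgA -expgS.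
Qed.

Lemma invg_a : (a^-1 = a ^+ M.-1)%g.
Proof. by apply: (mulgI a); rewrite mulgV -expgS prednK. Qed.

Lemma invg_b : (b^-1 = b ^+ N.-1 * a ^+ (M.-1 * e))%g.
Proof.
apply: (mulgI b); rewrite mulgV mulgA -expgS prednK // bN -expgnDr -mulSn.
by rewrite prednK // expgM aM expg1n.
Qed.

Lemma normal_form_bounded x : in_normal_form a b x ->
  exists c : 'I_M * 'I_N, (x = a ^+ c.1 * b ^+ c.2)%g.
Proof.
move=> [i [j ->]].
exists (Ordinal (ltn_pmod (i + e * (j %/ N)) M_gt0),
        Ordinal (ltn_pmod j N_gt0)) => /=.
have aX h : (a ^+ (h %% M) = a ^+ h)%g.
  by rewrite [in RHS](divn_eq h M) mulnC expgnDr expgM aM expg1n mul1g.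
by rewrite aX expgnDr expgM -bN -expgM -mulgA -expgnDr mulnC -divn_eq.
Qed.

End NormalForm.

(** * The metacyclic presentation *)

Section IsoB.
Variables (m N : nat) (R : multiplier m N) (M Rz : int).
Local Notation E := ((1 * M) %/ gcdz M (Rz - 1))%Z.
Variables (w u : residue m).
Hypothesis MN : (`|M| * N = m.+1)%N.
Hypothesis RzE : Rz%:~R = R :> residue m.
Hypothesis wu : w * u = 1.
Hypothesis bN_E : \sum_(j < N) (R : residue m) ^+ j = E%:~R * (N%:R * w).

(* For any unit w these elements satisfy the first two relations of B; only the
   third one, expressed by bN_E, restricts w. *)
Let a : twisted R := N%:R * w.
Let b : twisted R := (1 : residue m).
Let rels : seq (word bool * word bool) :=
  [:: (wexp (gen false) M, [::]);
      (gen true ++ gen false ++ winv (gen true), wexp (gen false) Rz);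
      (wexp (gen true) N, wexp (gen false) E)].
Let ga : presented rels := pres_gen rels false.
Let gb : presented rels := pres_gen rels true.

Lemma twist_a i : twist R (i * (a : residue m)) = 1.
Proof. by rewrite mulrCA twistMN. Qed.

Lemma a_exp i : (a ^+ i)%g = i%:R * (a : residue m) :> residue m.
Proof.
elim: i => [|i IHi]; first by rewrite mul0r.
by rewrite expgSr twistedM IHi twist_a mul1r -natr1 mulrDl mul1r.
Qed.

Lemma a_expz z : expgz a z = z%:~R * (a : residue m) :> residue m.
Proof.
case: z => i; first exact: a_exp.
rewrite /= expVgn; apply: (@mulgI (twisted R) (a ^+ i.+1)%g); rewrite mulgV.
apply/esym; apply: etrans (twistedM _ _) _; rewrite a_exp twist_a NegzE mul1r.
by rewrite rmorphN /= mulNr subrr.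
Qed.

Lemma b_exp j : (b ^+ j)%g = \sum_(h < j) (R : residue m) ^+ h :> residue m.
Proof.
elim: j => [|j IHj]; first by rewrite big_ord0.
rewrite expgS twistedM IHj big_ord_recl expr0 twist_eq1; last exact: one_mod1.
by rewrite mulr_sumr; congr (_ + _); apply: eq_bigr => h _; rewrite exprS.
Qed.

Lemma b_a z : (b * expgz a z = expgz a (Rz * z) * b)%g.
Proof.
apply: etrans (twistedM _ _) (etrans _ (esym (twistedM _ _))).
rewrite !a_expz twist_a mul1r twist_eq1; last exact: one_mod1.
by rewrite intrM RzE [RHS]addrC mulrA.
Qed.

(** Since R = 1 modulo N, the power b^x is x plus a multiple of N, and the powers
    of a exhaust the multiples of N because w is a unit. *)
Lemma twisted_span (x : twisted R) : in_normal_form a b x.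
Proof.
pose xv : residue m := x.
have [z zE] : exists z,
    \sum_(h < (xv : 'I_m.+1)) (R : residue m) ^+ h = xv + N%:R * z.
  suff sum_mod j :
      exists z, \sum_(h < j) (R : residue m) ^+ h = j%:R + N%:R * z.
    by have [z] := sum_mod (xv : 'I_m.+1); rewrite natr_residue => zE; exists z.
  elim: j => [|j [z IHj]].
    by exists 0; rewrite big_ord0; ring.
  rewrite big_ord_recr /= IHj.
  have [t ->] := one_modX j (multiplier_mod R).
  by exists (z + t); rewrite -natr1; ring.
exists ((- z * u : residue m) : 'I_m.+1), (xv : 'I_m.+1).
apply: etrans (esym (twistedM _ _)).
rewrite a_exp natr_residue twist_a mul1r b_exp zE.
have -> : - z * u * (a : residue m) = - (w * u) * (N%:R * z).
  by rewrite /a; ring.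
by rewrite wu -/xv; ring.
Qed.

Lemma card_exponents : (0 < `|M|)%N /\ (0 < N)%N.
Proof. by apply/andP; rewrite -muln_gt0 MN. Qed.

Theorem group_B_twisted : isomorphic (group_B M N Rz 1) (twisted R).
Proof.
have [M_gt0 N_gt0] := card_exponents.
have M0 : M != 0 by rewrite -absz_gt0.
pose g (c : bool) : twisted R := if c then b else a.
have rels_image p : p \in rels -> eval g p.1 = eval g p.2.
  rewrite !inE => /or3P[] /eqP ->; rewrite /fst /snd.
  - rewrite eval_wexp eval_gen eval_nil a_expz mulrA.
    have -> : M%:~R * N%:R = 0 :> residue m.
      rewrite [N%:R]pmulrn -intrM -[RHS]/(0%:~R).
      apply/(@residue_int_eq _ (M * N%:Z)).
        by rewrite abszM absz_nat MN.
      by rewrite modzz mod0z.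
    by rewrite mul0r.
  - rewrite !eval_cat eval_winv !eval_wexp !eval_gen /g.
    by rewrite mulgA (b_a 1) mulr1 mulgK.
  - by rewrite !eval_wexp !eval_gen /g a_expz; apply: etrans (b_exp N) bN_E.
have [phi phiE] := pres_lift rels_image.
have phiX i j : phi (ga ^+ i * gb ^+ j)%g = (a ^+ i * b ^+ j)%g.
  have := phiE (wexp (gen false) i%:Z ++ wexp (gen true) j%:Z).
  by rewrite !eval_cat !eval_wexp !eval_gen.
have gaM : expgz ga M = 1%g.
  have := @pres_relation _ rels (wexp (gen false) M, [::]) (mem_head _ _).
  by rewrite eval_wexp eval_gen eval_nil.
have gaz z := expgz_modn z M0 gaM.
have gba : (gb * ga = ga ^+ `|(Rz %% M)%Z| * gb)%g.
  have := @pres_relation _ rels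
    (gen true ++ gen false ++ winv (gen true), wexp (gen false) Rz).
  rewrite !eval_cat eval_winv eval_wexp !eval_gen gaz => <-.
    by rewrite mulgA mulgVK.
  by rewrite !inE eqxx orbT.
have gbN : (gb ^+ N = ga ^+ `|(E %% M)%Z|)%g.
  have := @pres_relation _ rels (wexp (gen true) N, wexp (gen false) E).
  by rewrite !eval_wexp !eval_gen gaz; apply; rewrite !inE eqxx !orbT.
have gaM' := expgz_eq1 gaM.
have span x : exists c : 'I_`|M| * 'I_N, (x = ga ^+ c.1 * gb ^+ c.2)%g.
  apply: (normal_form_bounded M_gt0 N_gt0 gaM' gbN).
  elim/pres_ind: x => [|c x IHx|c x IHx].
  - by exists 0%N, 0%N; rewrite mulg1.
  - case: c.
      by rewrite -[pres_gen rels _]expg1; apply: (normal_form_mul_b gba).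
    by rewrite -[pres_gen rels _]expg1; apply: normal_form_mul_a.
  - case: c; last first.
      by rewrite (invg_a M_gt0 gaM'); apply: normal_form_mul_a.
    rewrite (invg_b M_gt0 N_gt0 gaM' gbN) -mulgA.
    by apply: (normal_form_mul_b gba); apply: normal_form_mul_a.
pose F (c : 'I_`|M| * 'I_N) : twisted R := (a ^+ c.1 * b ^+ c.2)%g.
have phi_surj y : exists x, phi x = y.
  by have [i [j ->]] := twisted_span y; exists (ga ^+ i * gb ^+ j)%g.
(* A surjection between sets of the same size |M| N = m + 1 is injective. *)
have F_surj y : exists c, F c == y.
  have [x <-] := phi_surj y; have [c ->] := span x.
  by exists c; rewrite phiX.
have F_inj : injective F.
  have GK : cancel (fun y => xchoose (F_surj y)) F.
    by move=> y; apply/eqP/(xchooseP (F_surj y)).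
  apply: bij_inj; apply: (bij_can_bij _ GK); apply: inj_card_bij (can_inj GK) _.
  by rewrite card_twisted card_prod !card_ord MN.
exists phi; apply: bij_of_inj_surj phi_surj => x y.
have [c ->] := span x; have [d ->] := span y.
by rewrite !phiX => /F_inj ->.
Qed.

Lemma metacyclic_twisted : metacyclic [set: twisted R].
Proof.
have [k kE] : exists k : nat, k%:R = R :> residue m.
  by exists ((R : residue m) : 'I_m.+1); rewrite natr_residue.
apply: (metacyclic_of_commutation (a := a) (b := b) (k := k) _ twisted_span).
apply: etrans (twistedM _ _) (etrans _ (esym (twistedM _ _))).
rewrite a_exp twist_a mul1r twist_eq1; last exact: one_mod1.
by rewrite kE addrC.
Qed.

End IsoB.

(** * Arithmetic of the parameters *)

Lemma intrX (A : pzRingType) (z : int) k : (z ^+ k)%:~R = z%:~R ^+ k :> A.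
Proof. exact: rmorphXn. Qed.

(** Modulo N all N terms are equal. *)
Lemma dvdz_sumXX (N : nat) (x y : int) : (N%:Z %| x - y)%Z ->
  (N%:Z %| \sum_(i < N) x ^+ (N.-1 - i) * y ^+ i)%Z.
Proof.
move=> Nxy.
rewrite -[\sum_(i < N) _](subrK (\sum_(i < N) y ^+ N.-1)).
apply: rpredD; last first.
  by rewrite sumr_const card_ord -mulr_natl natz dvdz_mulr.
rewrite -sumrB; apply: rpred_sum => i _.
have -> : y ^+ N.-1 = y ^+ (N.-1 - i) * y ^+ i.
  by rewrite -exprD subnK // -ltnS prednK ?(leq_ltn_trans _ (ltn_ord i)).
by rewrite -mulrBl dvdz_mulr // subrXX dvdz_mulr.
Qed.

(** The two congruences say that R is a power of y / x and that y / x is a power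
    of R.  By the first, R = 1 modulo x - y, where x is invertible; by the second,
    x = y modulo every divisor of D modulo which R = 1. *)
Lemma gcdz_parameters (x y M D Rz : int) (i j : nat) :
    (x - y %| M)%Z -> (M %| D)%Z -> coprimez (x - y) x ->
    (D %| x ^+ i * Rz - y ^+ i)%Z -> (D %| x * Rz ^+ j - y)%Z ->
  gcdz M (Rz - 1) = `|x - y|.
Proof.
move=> xyM MD xy_x Di Dj.
have xy_g : (x - y %| gcdz M (Rz - 1))%Z.
  rewrite dvdz_gcd xyM /= -(@Gauss_dvdzr (x - y) (x ^+ i)) ?coprimezXr //.
  have -> : x ^+ i * (Rz - 1) = (x ^+ i * Rz - y ^+ i) - (x ^+ i - y ^+ i).
    by ring.
  apply: rpredB; first exact: dvdz_trans (dvdz_trans xyM MD) Di.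
  by rewrite subrXX dvdz_mulr.
have g_xy : (gcdz M (Rz - 1) %| x - y)%Z.
  have -> : x - y = (x * Rz ^+ j - y) - x * (Rz ^+ j - 1) by ring.
  apply: rpredB; first exact: dvdz_trans (dvdz_trans (dvdz_gcdl _ _) MD) Dj.
  rewrite dvdz_mull // -[X in _ ^+ j - X](expr1n _ j) subrXX dvdz_mulr //.
  exact: dvdz_gcdr.
rewrite -[LHS]gez0_abs // -abszE; apply/congr1/eqP.
by rewrite eqn_dvd -!dvdzE g_xy.
Qed.

Lemma coprimez_inverse (N a b : int) : (a * b = 1 %[mod N])%Z -> coprimez N b.
Proof.
move/eqP; rewrite eqz_mod_dvd => /dvdzP[k kE].
apply/coprimezP; exists (- k, a) => /=.
by rewrite mulNr -kE; ring.
Qed.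

(** Multiplication by z permutes the exponents modulo N. *)
Lemma sum_perpow (A : pzRingType) (Q : A) (N : nat) z : (0 < N)%N ->
    Q ^+ N = 1 -> coprimez N z ->
  \sum_(j < N) perpow Q N z ^+ j = \sum_(j < N) Q ^+ j.
Proof.
move=> N_gt0 QN zN; pose h (j : 'I_N) := subscript N_gt0 (z * j%:Z).
have h_inj : injective h.
  move=> i j /(congr1 (fun k : 'I_N => (k%:Z %% N)%Z)); rewrite !subscript_val.
  move/eqP; rewrite eqz_mod_dvd -mulrBr Gauss_dvdzr // -eqz_mod_dvd !modz_nat.
  by rewrite eqz_nat !modn_small ?ltn_ord // => /eqP/val_inj.
by rewrite [RHS](reindex_inj h_inj); apply: eq_bigr => j _; rewrite perpowX.
Qed.

(** With rho = 1 / x, a geometric sum of ratio y / x in homogeneous form; the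
    closed form would need y / x - 1 to be invertible. *)
Lemma sum_powers_ratio (A : comPzRingType) (x y rho : A) (N : nat) :
    x * rho = 1 ->
  \sum_(j < N) (rho * y) ^+ j =
    (\sum_(j < N) x ^+ (N.-1 - j) * y ^+ j) * rho ^+ N.-1.
Proof.
move=> x_rho; rewrite mulr_suml; apply: eq_bigr => j _.
have -> : rho ^+ N.-1 = rho ^+ (N.-1 - j) * rho ^+ j.
  by rewrite -exprD subnK // -ltnS prednK // (leq_ltn_trans _ (ltn_ord j)).
transitivity ((x * rho) ^+ (N.-1 - j) * (rho * y) ^+ j).
  by rewrite x_rho expr1n mul1r.
by rewrite !exprMn; ring.
Qed.

Lemma expz_mod_perpow (m n : nat) (D u e : int) : `|D|%N = m.+1 -> (0 < n)%N ->
    (u%:~R : residue m) ^+ n = 1 ->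
  (expz_mod D u e)%:~R = perpow (u%:~R : residue m) n e.
Proof.
move=> DE n_gt0 un; case: e => k /=; first by rewrite (perpow_nat un) rmorphXn.
have pu : (invz_mod D u)%:~R * u%:~R = 1 :> residue m.
  have uD : coprimez u D.
    rewrite coprimez_sym; apply: (@coprimez_inverse _ (u ^+ n.-1)).
    rewrite -exprSr prednK //.
    by apply/(residue_int_eq _ _ DE); rewrite rmorphXn.
  have uv1 : (egcdz u D).1 * u + (egcdz u D).2 * D = 1.
    by case: egcdzP => a b -> _; apply/eqP.
  rewrite -intrM -[RHS]/(1%:~R); apply/(residue_int_eq _ _ DE).
  by rewrite -uv1 addrC modzMDl.
have -> : perpow (u%:~R : residue m) n (Negz k)
    = ((invz_mod D u)%:~R * u%:~R) ^+ k.+1 * perpow (u%:~R) n (Negz k).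
  by rewrite pu expr1n mul1r.
rewrite exprMn -mulrA -(perpow_nat un) -perpowD // NegzE subrr.
by rewrite (perpow_nat un 0) mulr1 rmorphXn.
Qed.

(** * The isomorphism theorem *)

Theorem corollary8 (n r s : nat) (l f : int)
    (n_gt0 : (0 < n)%N) (r_gt0 : (0 < r)%N) (s_gt0 : (0 < s)%N)
    (n_l1 : gcdz n (l - 1) = 1) (r_s : coprime r s) (r_neq_s : r <> s)
    (f_rs : (f * (r%:Z - s%:Z) = 0 %[mod n])%Z)
    (Abar rhat R : int)
    (AbarE : ((l - 1) * Abar = 1 %[mod n])%Z)
    (rhatE : (r%:Z * rhat = 1 %[mod r%:Z ^+ n - s%:Z ^+ n])%Z)
    (RE : (R = expz_mod (r%:Z ^+ n - s%:Z ^+ n) (s%:Z * rhat) (f * Abar)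
             %[mod r%:Z ^+ n - s%:Z ^+ n])%Z) :
  let D : int := r%:Z ^+ n - s%:Z ^+ n in
  let M : int := ((gcdz n f * D) %/ n)%Z in
  let N : int := (n %/ gcdz n f)%Z in
  [/\ (n %| gcdz n f * D)%Z,
      group_B_condition M N R,
      isomorphic (group_P n_gt0 r l s f) (group_B M N R 1)
    & metacyclic_of_order (group_P n_gt0 r l s f) `|D|%N].
Proof.
move=> D M N'.
pose d := gcdn n `|f|; pose N := (n %/ d)%N; pose f' := (f %/ d)%Z.
have d_gt0 : (0 < d)%N by rewrite gcdn_gt0 n_gt0.
have nE : n = (d * N)%N by rewrite mulnC divnK // dvdn_gcdl.
have fE : f = d%:Z * f' by rewrite mulrC divzK // dvdzE dvdn_gcdr.
have N_gt0 : (0 < N)%N by move: n_gt0; rewrite {1}nE muln_gt0 => /andP[].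
have N'E : N' = N%:Z by rewrite [LHS]divz_nat.
have gdE : gcdz n f = d%:Z by [].
have d0 : d%:Z != 0 by rewrite eqz_nat -lt0n.
have f'N : coprimez N f'.
  have : gcdz (d%:Z * N%:Z) (d%:Z * f') = d%:Z * 1.
    by rewrite -PoszM -nE -fE mulr1.
  by rewrite -mulz_gcdr // => /(mulfI d0) /eqP.
have AbarN : coprimez N Abar.
  apply: (@coprimez_inverse _ (l - 1)); apply/eqP; rewrite eqz_mod_dvd.
  apply: (@dvdz_trans n); first by rewrite nE PoszM dvdz_mull.
  by rewrite -eqz_mod_dvd; apply/eqP.
have N_rs : (N%:Z %| r%:Z - s%:Z)%Z.
  have : (n%:Z %| f * (r%:Z - s%:Z))%Z.
    by rewrite -[f * _]subr0 -eqz_mod_dvd; apply/eqP.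
  by rewrite {1}nE fE PoszM -mulrA dvdz_mul2l // Gauss_dvdzr.
(* E' N is the sum of the x^(N-1-i) y^i, so that D = (x - y) E' N. *)
pose x : int := r%:Z ^+ d; pose y : int := s%:Z ^+ d.
have N_xy : (N%:Z %| x - y)%Z by rewrite subrXX dvdz_mulr.
have /dvdzP[E' EE'] := dvdz_sumXX N_xy.
have DE : D = (x - y) * E' * N%:Z.
  by rewrite -mulrA -EE' -subrXX -!exprM -nE.
have ME : M = (x - y) * E'.
  rewrite /M gdE DE nE PoszM divzMpl //.
  by rewrite mulzK // eqz_nat -lt0n.
have D0 : D != 0.
  rewrite subr_eq0 -!PoszX eqz_nat eqn_exp2r //; exact/eqP.
pose m := `|D|.-1; have mE : `|D|%N = m.+1 by rewrite prednK // absz_gt0.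
have resP a b := @residue_int_eq m D a b mE.
pose q : residue m := (s%:Z * rhat)%:~R.
have r_rhat : r%:R * rhat%:~R = 1 :> residue m.
  by rewrite [r%:R]pmulrn -intrM; apply/(resP _ 1).
have rq : r%:R * q = s%:R.
  by rewrite /q intrM mulrCA r_rhat mulr1.
have rnE : r%:R ^+ n = s%:R ^+ n :> residue m.
  have : (r%:Z ^+ n)%:~R = (s%:Z ^+ n)%:~R :> residue m.
    by apply/resP/eqP; rewrite eqz_mod_dvd dvdzz.
  by rewrite !intrX.
have qn1 : q ^+ n = 1.
  rewrite /q intrM exprMn -rnE.
  by rewrite -exprMn r_rhat expr1n.
have q_1mod : one_mod N q.
  have /dvdzP[k kE] := N_rs.
  exists (- k%:~R * rhat%:~R).
  have -> : q = (r%:Z * rhat - N%:Z * k * rhat)%:~R.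
    by rewrite [N%:Z * k]mulrC -kE /q; congr (_%:~R); ring.
  by rewrite intrB !intrM r_rhat; ring.
(* R = Q^z with Q = q^d of order dividing N and z prime to N. *)
pose z : int := f' * Abar.
have zN : coprimez N z by rewrite coprimezMr f'N.
have [z' zz'] : exists z', (z * z' = 1 %[mod N])%Z.
  have /coprimezP[[u v] /= uv] := zN; exists v.
  by apply/eqP; rewrite eqz_mod_dvd -uv; apply/dvdzP; exists (- u); ring.
pose Q := q ^+ d.
have QN1 : Q ^+ N = 1 by rewrite -exprM -nE.
have RresE : perpow q n (f * Abar) = perpow Q N z.
  by rewrite nE fE -mulrA perpow_mulr.
have RzE : R%:~R = perpow Q N z.
  rewrite -RresE -(expz_mod_perpow _ mE n_gt0 qn1).
  by apply/resP.
have Rn1 : perpow Q N z ^+ N = 1 by rewrite -exprM mulnC exprM QN1 expr1n.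
have R_1mod : one_mod N (perpow Q N z).
  by rewrite /perpow -exprM; apply: one_modX.
have N_dvd : (N %| m.+1)%N by rewrite -mE DE abszM absz_nat dvdn_mull.
pose Rm := Multiplier N_dvd Rn1 R_1mod.
have MD : (M %| D)%Z by rewrite DE -ME dvdz_mulr.
pose rho : residue m := rhat%:~R ^+ d.
have x_rho : x%:~R * rho = 1 by rewrite intrX -exprMn r_rhat expr1n.
have QE : Q = rho * y%:~R by rewrite /Q /q intrM mulrC exprMn intrX.
have xQ : x%:~R * Q = y%:~R by rewrite QE mulrA x_rho mul1r.
have gE : gcdz M (R - 1) = `|x - y|.
  (* R is the power of Q = y / x of exponent z, and Q that of R of exponent z'. *)
  apply: (@gcdz_parameters x y M D R `|(z %% N)%Z| `|(z' %% N)%Z|) => //.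
  - by rewrite ME dvdz_mulr.
  - rewrite coprimezXr // coprimezE; apply: (@coprime_dvdl _ `|D|).
      by rewrite -dvdzE DE -mulrA dvdz_mulr.
    by rewrite -coprimezE; apply: (@coprimez_inverse _ rhat); rewrite mulrC.
  - rewrite -eqz_mod_dvd; apply/eqP/resP.
    by rewrite intrM (intrX _ x) (intrX _ y) RzE -exprMn xQ.
  - rewrite -eqz_mod_dvd; apply/eqP/resP.
    rewrite intrM intrX RzE perpowX // (_ : perpow _ _ _ = Q) //.
    rewrite -[RHS]expr1 -(perpow_nat QN1); apply: perpow_mod.
    by rewrite gez0_abs ?modz_ge0 ?eqz_nat -?lt0n // modzMmr.
have xy0 : x - y != 0 by apply: contraNneq D0; rewrite DE => ->; rewrite !mul0r.
pose sg := sgz (x - y).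
have sg2 : sg%:~R * sg%:~R = 1 :> residue m.
  by rewrite -intrM /sg; case: sgzP xy0.
have EE : ((1 * M) %/ gcdz M (R - 1))%Z = sg * E'.
  rewrite mul1r gE -abszE ME [X in (X * E')]intEsg mulrAC mulzK //.
  by rewrite eqz_nat absz_eq0.
have bN_E : \sum_(j < N) (Rm : residue m) ^+ j =
    ((1 * M) %/ gcdz M (R - 1))%Z%:~R * (N%:R * (sg%:~R * rho ^+ N.-1)).
  rewrite EE sum_perpow //.
  transitivity (sg%:~R * sg%:~R * ((E' * N%:Z)%:~R * rho ^+ N.-1));
    last by rewrite !intrM; ring.
  rewrite sg2 mul1r.
  rewrite QE (sum_powers_ratio _ _ x_rho) -EE' rmorph_sum; congr (_ * _).
  by apply: eq_bigr => i _ /=; rewrite intrM (intrX _ x) (intrX _ y).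
have wu : (sg%:~R * rho ^+ N.-1) * (sg%:~R * x%:~R ^+ N.-1) = 1.
  by rewrite mulrACA sg2 mul1r -exprMn [rho * _]mulrC x_rho expr1n.
have MN : (`|M| * N = m.+1)%N by rewrite -mE DE -ME abszM absz_nat.
have isoP : isomorphic (group_P n_gt0 r l s f) (twisted Rm).
  pose rh : nat := (rhat%:~R : residue m) : 'I_m.+1.
  apply: (@group_P_twisted n n_gt0 r s l f Abar m N Rm q rh) => //.
  by apply/residue_nat_eq; rewrite natrM /rh natr_residue r_rhat.
split.
- by rewrite gdE DE nE PoszM dvdz_mul // dvdz_mull.
- rewrite /group_B_condition N'E /=; apply/eqP; rewrite eqz_mod_dvd.
  apply: dvdz_trans MD _; rewrite -eqz_mod_dvd; apply/eqP/(resP _ 1).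
  by rewrite intrX RzE.
- apply: isomorphic_common isoP _; rewrite N'E.
  exact: (group_B_twisted (R := Rm) MN RzE wu bN_E).
- exists (twisted Rm); split=> //; first by rewrite card_twisted mE.
  exact: (metacyclic_twisted Rm wu).
Qed.
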